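(* If $A$ is a Banach-Saks set in Schreier's space $S$, then the absolutely convex closed hull of $A$ is a Banach-Saks set.
   Context: A finite subset $A=\{n_1<\cdots<n_k\}$ of $\mathbb{N}=\{1,2,\dots\}$ is admissible if $k\le n_1$. Schreier's space $S$ is the completion of the space $c_{00}$ of finitely supported scalar sequences under the norm $\|x\|_S=\sup\{\sum_{j\in A}|x_j| : A\subset\mathbb{N}\text{ admissible}\}$. A subset $A$ of a Banach space is a Banach-Saks set if every sequence in $A$ has a subsequence whose arithmetic means converge in norm. *)

(* Defs.v *)
(* MathComp-Analysis; R[i] comes from real-closed. *)
From HB Require Import structures.
From mathcomp Require Import all_boot all_order all_algebra finmap.
From mathcomp Require Import complex.
From mathcomp Require Import all_classical all_reals all_analysis.
Set Implicit Arguments.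
Unset Strict Implicit.
Unset Printing Implicit Defensive.
Import Order.TTheory GRing.Theory Num.Theory.
Import numFieldNormedType.Exports.

Local Open Scope classical_set_scope.
Local Open Scope ring_scope.

(* The scalars are real or complex.  Over K = R[i] norms are K-valued, with
   nonnegative real values, and z <= w means that w - z is real and >= 0. *)
Definition scalar_field (R : realType) (K : numFieldType) : Prop :=
  K = R :> numFieldType \/ K = (complex R) :> numFieldType.

Definition finitely_supported (K : numFieldType) : {pred nat -> K} :=
  fun x => `[< finite_set [set n | x n != 0] >].

Lemma finitely_supported_submod_closed (K : numFieldType) :
  submod_closed (@finitely_supported K).
Proof.
split=> [|a x y /asboolP xf /asboolP yf]; apply/asboolP.
  rewrite (_ : mkset _ = set0) //; apply/seteqP; split=> // n /=.
  by rewrite /GRing.zero /= eqxx.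
apply: (@sub_finite_set _ _ ([set n | x n != 0] `|` [set n | y n != 0])).
  move=> n /=; case: (eqVneq (x n) 0) => [xn0|]; last by left.
  case: (eqVneq (y n) 0) => [yn0|]; last by right.
  by rewrite !fctE xn0 yn0 scaler0 addr0 eqxx.
by rewrite finite_setU.
Qed.

HB.instance Definition _ (K : numFieldType) :=
  GRing.isSubmodClosed.Build K (nat -> K) (@finitely_supported K)
    (@finitely_supported_submod_closed K).

(* Coordinates are numbered from 0: x n is the coordinate x_{n+1} of a
   sequence indexed by {1, 2, ...}. *)
Record c00 (K : numFieldType) := C00 {
  c00_val :> nat -> K ;
  c00_finitely_supported : c00_val \in @finitely_supported K }.
HB.instance Definition _ (K : numFieldType) := [isSub for @c00_val K].
HB.instance Definition _ (K : numFieldType) := [Choice of c00 K by <:].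
HB.instance Definition _ (K : numFieldType) :=
  [SubChoice_isSubLmodule of c00 K by <:].

(* #|A| <= min A.  The indices are numbered from 1: the condition forces
   0 \notin A. *)
Definition admissible (A : {fset nat}) : Prop :=
  forall n, n \in A -> (#|` A | <= n)%N.

Definition schreier_sums (K : numFieldType) (x : c00 K) : set K :=
  [set \sum_(j <- A) `|x j.-1| | A in [set A : {fset nat} | admissible A]].

Definition schreier_norm (K : numFieldType) (x : c00 K) : K :=
  supremum 0 (schreier_sums x).

(* S, with the embedding iota of c00, is the completion of c00 for the
   Schreier norm; this determines (S, iota) up to a unique linear isometry. *)
Definition schreier_space (K : numFieldType) (S : completeNormedModType K)
    (iota : {linear c00 K -> S}) : Prop :=
  (forall x, `|iota x| = schreier_norm x) /\ dense (range iota).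

Definition arith_mean (K : numFieldType) (V : normedModType K)
    (u : nat -> V) : nat -> V :=
  fun n => n.+1%:R^-1 *: \sum_(i < n.+1) u i.

Definition banach_saks (K : numFieldType) (V : normedModType K)
    (A : set V) : Prop :=
  forall u : nat -> V, (forall n, A (u n)) ->
    exists2 phi : nat -> nat,
      {homo phi : m n / (m < n)%N} & cvg (arith_mean (u \o phi) @ \oo).

Definition absolutely_convex (K : numFieldType) (V : lmodType K)
    (C : set V) : Prop :=
  forall x y (a b : K), C x -> C y -> `|a| + `|b| <= 1 ->
    C (a *: x + b *: y).

Definition absconvex_closed_hull (K : numFieldType) (V : normedModType K)
    (A : set V) : set V :=
  smallest [set C : set V | closed C /\ absolutely_convex C] A.

(* Main.v *)
(* Call a sequence in S coordinatewise convergent when its coordinates converge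
   to those of an element of S. A is a Banach-Saks set if and only if
   (1) A is bounded,
   (2) the coordinates of the elements of A tend to 0 uniformly on A, and
   (3) every sequence in A has a coordinatewise convergent subsequence.
   Indeed a bounded sequence tending to 0 uniformly in the coordinates has a
   subsequence whose partial sums are bounded in S, because an admissible set
   sees the essential part of at most one of its terms; conversely, if (2) fails
   then a subsequence, once its limit is subtracted, behaves like the unit
   vector basis, whose means do not tend to 0. Conditions (1) and (2) clearly
   pass to the absolutely convex closed hull. For (3), a limit of convex
   combinations that is not in S has mass bounded below on infinitely many far
   away admissible sets; the coefficients of the combinations are measures on A,
   and sets of measure bounded below contain a subsequence with the finite
   intersection property, which gives a sequence in A violating (3). *)
Require Import Defs.
From mathcomp Require Import all_boot all_order all_algebra finmap.
From mathcomp Require Import complex ring lra.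
From mathcomp Require Import all_classical all_reals all_analysis.
Set Implicit Arguments.
Unset Strict Implicit.
Unset Printing Implicit Defensive.
Import Order.TTheory GRing.Theory Num.Theory.
Import numFieldNormedType.Exports.
Local Open Scope classical_set_scope.
Local Open Scope ring_scope.

(** * Scalars, ultrafilter limits and sparse subsequences *)

Lemma real_ultra_lim (R : realType) (U : set_system nat) (z : nat -> R)
    (M : R) :
  UltraFilter U -> (forall n, `|z n| <= M) ->
  exists l, forall e, 0 < e -> U [set k | `|z k - l| < e].
Proof.
move=> UU zM.
have zU : (z @ U) `[- M, M]%classic.
  rewrite -[_ _]/(U (z @^-1` `[- M, M]%classic)).
  apply: filterS (@filterT _ U _) => k _ /=.
  by rewrite in_itv /= -ler_norml.
have [l [_ zl]] := @segment_compact R (- M) M (z @ U) _ zU.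
exists l => e e0.
have [//|Ue] := in_ultra_setVsetC [set k | `|z k - l| < e] UU.
have [r [ze le]] : ~` ball l e `&` ball l e !=set0.
  apply: zl; last exact: nbhsx_ballx.
  rewrite -[_ _]/(U (z @^-1` ~` ball l e)).
  by apply: filterS Ue => k /= zke; rewrite /ball /= distrC.
by case: (ze le).
Qed.

(** Real and complex scalars are treated at once: later arguments use only these properties of
    [rho]. Over the complex numbers the limit is taken in real and imaginary parts separately. *)
Lemma scalar_field_emb (R : realType) (K : numFieldType) :
  scalar_field R K ->
  exists rho : {rmorphism R -> K},
    [/\ {mono rho : x y / x <= y},
        forall x : K, x \is Num.real -> exists r, x = rho r &
        forall (U : set_system nat) (z : nat -> K) (M : R), UltraFilter U ->
          (forall n, `|z n| <= rho M) ->
          exists l, forall e, 0 < e -> U [set k | `|z k - l| < rho e]].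
Proof.
case=> ->.
  exists idfun; split=> //; first by move=> x _; exists x.
  by move=> U z M; exact: real_ultra_lim.
exists (real_complex R); split.
- by move=> x y; rewrite lecR.
- by move=> x /complex_realP.
move=> U z M UU zM.
have zRe n : `|complex.Re (z n)| <= M.
  by rewrite -lecR (le_trans (normc_ge_Re _)).
have zIm n : `|complex.Im (z n)| <= M.
  have := normc_ge_Re (z n * 'i%C).
  rewrite ReiNIm normrN normrM -lecR => /le_trans; apply.
  rewrite (_ : `|'i%C| = 1) ?mulr1 //.
  by rewrite normc_def /= expr0n /= add0r expr1n sqrtr1.
have [a za] := real_ultra_lim UU zRe.
have [b zb] := real_ultra_lim UU zIm.
exists (Complex a b) => e e0.
have e2 : 0 < e / 2 by rewrite divr_gt0.
apply: filterS (filterI (za _ e2) (zb _ e2)) => k /= [ka kb].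
case: (z k) ka kb => x y /= ka kb.
have -> : (Complex x y - Complex a b = (x - a)%:C%C + 'i%C * (y - b)%:C%C)%C.
  by simpc.
rewrite (le_lt_trans (ler_normD _ _)) // normrM.
rewrite (_ : `|'i%C| = 1) ?mul1r; last first.
  by rewrite normc_def /= expr0n /= add0r expr1n sqrtr1.
have nr (r : R) : `|(r%:C)%C| = (`|r|%:C)%C :> R[i].
  by rewrite normc_def /= expr0n /= addr0 sqrtr_sqr.
by rewrite !nr -rmorphD ltcR (splitr e) ltrD.
Qed.

Lemma near_all_seq (s : seq nat) (P : nat -> nat -> Prop) :
  (forall i, \forall n \near \oo, P i n) ->
  \forall n \near \oo, forall i, i \in s -> P i n.
Proof.
move=> Pnear; elim: s => [|i s IH]; first by near=> n.
near=> n => k; rewrite in_cons => /predU1P[->|]; last by move: k; near: n.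
by near: n; exact: Pnear.
Unshelve. all: by end_near. Qed.

Lemma sparse_subsequence (P : nat -> nat -> nat -> Prop) (n0 : nat) :
  (forall k m, \forall n \near \oo, P k m n) ->
  exists phi : nat -> nat, [/\ {homo phi : m n / (m < n)%N},
    forall k, (n0 <= phi k)%N & forall i k, (i < k)%N -> P k (phi i) (phi k)].
Proof.
move=> Pnear.
(* Asking for all [m <= p] at once lets the recursion remember only the last chosen index [p]. *)
have /choice [g gP] : forall kp : nat * nat, exists n,
    (kp.2 < n)%N /\ forall m, (m <= kp.2)%N -> P kp.1 m n.
  move=> [k p] /=.
  have [q _ qP] := near_all_seq (iota 0 p.+1) (Pnear k).
  exists (maxn q p.+1); split; first exact: leq_maxr.
  move=> m mp; apply: qP; first by rewrite /= leq_maxl.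
  by rewrite mem_iota.
pose phi := fix phi k := if k is k'.+1 then g (k, phi k') else n0.
have phiS k : phi k.+1 = g (k.+1, phi k) by [].
have incr k : (phi k < phi k.+1)%N by rewrite phiS; case: (gP (k.+1, phi k)).
have homo : {homo phi : m n / (m < n)%N}.
  by apply: homo_ltn => // y x z; exact: ltn_trans.
exists phi; split=> //.
  by elim=> // k /leq_trans; apply; exact: ltnW.
move=> i [//|k]; rewrite ltnS phiS => ik.
have [_] := gP (k.+1, phi k); apply => /=.
by move: ik; rewrite leq_eqVlt => /predU1P[->//|/homo /ltnW].
Qed.

Lemma homo_ltn_ge (phi : nat -> nat) :
  {homo phi : m n / (m < n)%N} -> forall n, (n <= phi n)%N.
Proof. by move=> h; elim=> // n /leq_ltn_trans; apply; exact: h. Qed.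

Lemma near_homo (P : nat -> Prop) (phi : nat -> nat) :
  {homo phi : m n / (m < n)%N} ->
  (\forall n \near \oo, P n) -> \forall n \near \oo, P (phi n).
Proof.
move=> hphi [n _ nP]; exists n => // m /= nm; apply: nP => /=.
exact: leq_trans nm (homo_ltn_ge hphi m).
Qed.

(** * Families of sets of large mass *)

Section LargeIntersections.
Variables (R : realType) (T : Type) (lam : nat -> set T -> R).
Variables (W : nat -> set T) (d : R).
Hypothesis lam_ge0 : forall k X, 0 <= lam k X.
Hypothesis lam0 : forall k, lam k set0 = 0.
Hypothesis lam_le1 : forall k X, lam k X <= 1.
Hypothesis lamU : forall k X Y,
  lam k (X `|` Y) + lam k (X `&` Y) = lam k X + lam k Y.
Hypothesis d_gt0 : 0 < d.
Hypothesis lamW : forall k i, (i <= k)%N -> d <= lam k (W i).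
Variable U : set_system nat.
Context (UU : UltraFilter U).
Hypothesis ooU : \oo `<=` U.

(* "For [U]-most [k]" replaces a limit of [lam] along the ultrafilter. *)
Let big eta X := U [set k | eta <= lam k X].

Let good B := exists2 eta, 0 < eta &
  forall n, exists2 i, (n <= i)%N & big eta (B `&` W i).

Let Nbig eta X : ~ big eta X -> U [set k | lam k X < eta].
Proof.
have [//|UX _] := in_ultra_setVsetC [set k | eta <= lam k X] UU.
by apply: filterS UX => k /= /negP; rewrite -ltNge.
Qed.

Let Ngood B : ~ good B -> forall eta, 0 < eta ->
  exists n, forall i, (n <= i)%N -> U [set k | lam k (B `&` W i) < eta].
Proof.
move=> NB eta eta0; apply: contra_notP NB => /forallNP NB.
exists eta => // n; have /existsNP[i /not_implyP[ni Bi]] := NB n.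
by exists i => //; apply: contra_notP Bi; exact: Nbig.
Qed.

(** The sets that are not good form an ideal; in [good_step] this keeps a finite union of such
    pieces not good. *)
Let goodU X Y : good (X `|` Y) -> good X \/ good Y.
Proof.
move=> [eta eta0 XY]; apply: contrapT => /not_orP[].
have eta2 : 0 < eta / 2 by rewrite divr_gt0.
move=> /Ngood /(_ _ eta2)[n1 X1] /Ngood /(_ _ eta2)[n2 Y2].
have [i + XYi] := XY (maxn n1 n2); rewrite geq_max => /andP[/X1 Xi /Y2 Yi].
have [k /= [[kX kY] XYk]] := filter_ex (filterI (filterI Xi Yi) XYi).
rewrite setIUl in XYk.
have := lamU k (X `&` W i) (Y `&` W i).
have := lam_ge0 k ((X `&` W i) `&` (Y `&` W i)).
lra.
Qed.

(* Otherwise sets [B `&` W i] of mass at least [eta] with negligible pairwise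
   intersections would accumulate to a total mass above 1. *)
Let good_step B : good B ->
  forall n, exists2 i, (n <= i)%N & good (B `&` W i).
Proof.
move=> [eta eta0 Beta] n0; apply: contrapT => /forall2NP NB.
have {}NB i : (n0 <= i)%N -> ~ good (B `&` W i) by move=> ni; case: (NB i).
have eta2 : 0 < eta / 2 by rewrite divr_gt0.
have claim N : exists X, [/\ X `<=` B, ~ good X & big (N%:R * (eta / 2)) X].
  elim: N => [|N [X [XB NX bX]]].
    exists set0; split=> //.
      move=> [e e0 /(_ 0%N)[i _ ei]]; have [k /=] := @filter_ex _ U _ _ ei.
      by rewrite set0I lam0 leNgt e0.
    by apply: filterS (@filterT _ U _) => k _ /=; rewrite mul0r.
  (* As [X] is not good, a late [W j] meets it in mass below [eta / 2], so the part of [B] in [W j],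
     of mass at least [eta], adds [eta / 2]. *)
  have [n XW] := Ngood NX eta2.
  have [j + Bj] := Beta (maxn n n0); rewrite geq_max => /andP[nj n0j].
  exists (X `|` (B `&` W j)); split.
  - by move=> t [/XB|[]].
  - by move=> /goodU[//|]; exact: NB.
  apply: filterS
    (@filterI _ U _ _ _ (@filterI _ U _ _ _ bX Bj) (XW _ nj)) => k /= [[]].
  have -> : X `&` W j = X `&` (B `&` W j) by rewrite setIA (setIidl XB).
  have := lamU k X (B `&` W j); rewrite -(natr1 N) mulrDl mul1r; lra.
(* With this many pieces the total mass exceeds 1. *)
have [X [_ _ bX]] := claim (Num.bound (eta / 2)^-1).
have [k /=] := @filter_ex _ U _ _ bX; apply/negP; rewrite -ltNge.
apply: le_lt_trans (lam_le1 k X) _.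
rewrite -ltr_pdivrMr // mul1r.
by apply: le_lt_trans (archi_boundP _); rewrite // invr_ge0 ltW.
Qed.

Let goodT : good setT.
Proof.
exists d => // n; exists n => //; apply: ooU; exists n => // k /= nk.
by rewrite setTI; exact: lamW.
Qed.

(** [good_step] cuts the whole space with one [W i] after another and keeps the intersection good; a
    good set is nonempty, since the empty set has mass 0. *)
Lemma large_intersections_ultra : exists iota : nat -> nat,
  {homo iota : m n / (m < n)%N} /\
  forall n, exists a, forall m, (m <= n)%N -> W (iota m) a.
Proof.
have /choice[g gP] : forall p : set T * nat, exists i,
    good p.1 -> (p.2 < i)%N /\ good (p.1 `&` W i).
  move=> [B n] /=; have [/good_step/(_ n.+1)[i ni Bi]|NB] := pselect (good B).
    by exists i.
  by exists 0%N.
(* A state is the intersection so far with the last index used; the initial index 0 serves only as a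
   strict lower bound. *)
pose st := fix st n := if n is n'.+1 then
  (((st n').1 `&` W (g (st n'))), g (st n')) else (setT : set T, 0%N).
have st_good n : good (st n).1.
  by elim: n => [|n IH]; [exact: goodT | have [] := gP _ IH].
have incr n : ((st n.+1).2 < (st n.+2).2)%N.
  by have [] := gP _ (st_good n.+1).
exists (fun n => (st n.+1).2); split.
  by apply: homo_ltn => // y x z; exact: ltn_trans.
move=> n; have [eta eta0 /(_ 0%N)[i _ ei]] := st_good n.+1.
have [k /= big_k] := @filter_ex _ U _ _ ei.
have /set0P[a [[stna Wna] _]] : (st n.+1).1 `&` W i != set0.
  by apply: contraTN big_k => /eqP /= ->; rewrite lam0 -ltNge.
exists a => m; elim: n stna Wna {ei big_k} => [|n IH].
  by rewrite leqn0 => _ Wna /eqP ->.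
move=> stna Wna; rewrite leq_eqVlt => /predU1P[->//|mn].
by apply: IH => //; case: stna.
Qed.

End LargeIntersections.

Lemma free_ultrafilter : exists U : set_system nat, UltraFilter U /\ \oo `<=` U.
Proof. exact: ultraFilterLemma. Qed.

Lemma large_intersections (R : realType) (T : Type) (lam : nat -> set T -> R)
    (W : nat -> set T) (d : R) :
  (forall k X, 0 <= lam k X) -> (forall k, lam k set0 = 0) ->
  (forall k X, lam k X <= 1) ->
  (forall k X Y, lam k (X `|` Y) + lam k (X `&` Y) = lam k X + lam k Y) ->
  0 < d -> (forall k i, (i <= k)%N -> d <= lam k (W i)) ->
  exists iota : nat -> nat, {homo iota : m n / (m < n)%N} /\
    forall n, exists a, forall m, (m <= n)%N -> W (iota m) a.
Proof.
have [U [UU ooU]] := free_ultrafilter.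
move=> *.
by apply: (large_intersections_ultra (lam := lam) (d := d) _ _ _ _ _ _ UU).
Qed.

(** * Elementary estimates and admissible sets *)

(** For density arguments: [C] counts how often the approximation error [e] is paid. *)
Lemma le_addMeps (R : realFieldType) (x y C : R) : 0 <= C ->
  (forall e, 0 < e -> x <= y + C * e) -> x <= y.
Proof.
move=> C0 xy; apply/ler_addgt0Pr => e e0.
have C1 : 0 < C + 1 by rewrite ltr_wpDl.
apply: le_trans (xy (e / (C + 1)) _) _; first by rewrite divr_gt0.
by rewrite lerD2l mulrCA ger_pMr // ler_pdivrMr // mul1r lerDl.
Qed.

Lemma c00_bounded (K : numFieldType) (c : c00 K) :
  exists n, forall j, (n <= j)%N -> c j = 0.
Proof.
have /asboolP/finite_fsetP[F cF] := c00_finitely_supported c.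
exists (\max_(j <- F) j).+1 => j Fj; apply: contrapT => /eqP cj.
have : [set` F] j by rewrite -cF.
move=> /= jF; move: Fj; rewrite ltnNge => /negP; apply.
by rewrite (big_rem _ jF) leq_maxl.
Qed.

Lemma admissible1 j : admissible [fset j.+1]%fset.
Proof. by move=> n; rewrite in_fset1 => /eqP ->; rewrite cardfs1. Qed.

Lemma admissible_sub (E F : {fset nat}) :
  (E `<=` F)%fset -> admissible F -> admissible E.
Proof.
move=> EF aF n nE.
by rewrite (leq_trans (fsubset_leq_card EF)) // aF // (fsubsetP EF).
Qed.

Lemma admissible_gt0 (E : {fset nat}) j : admissible E -> j \in E -> (0 < j)%N.
Proof.
move=> aE jE; apply: leq_trans (aE _ jE).
by rewrite cardfs_gt0; apply/fset0Pn; exists j.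
Qed.

Lemma sum_half_le2 (R : realFieldType) n : \sum_(i < n) (2^-1 : R) ^+ i <= 2.
Proof.
suff -> : \sum_(i < n) (2^-1 : R) ^+ i = 2 - 2 * 2^-1 ^+ n.
  by rewrite gerBl mulr_ge0 // exprn_ge0 // invr_ge0.
elim: n => [|n IH]; first by rewrite big_ord0 expr0; ring.
by rewrite big_ord_recr /= IH exprS; field.
Qed.

Lemma arith_meanB (K : numFieldType) (V : normedModType K) (u : nat -> V) x n :
  arith_mean u n - x = n.+1%:R^-1 *: \sum_(i < n.+1) (u i - x).
Proof.
rewrite sumrB sumr_const card_ord scalerBr; congr (_ - _).
by rewrite -[x *+ _]scaler_nat scalerA mulVf ?scale1r // pnatr_eq0.
Qed.

Definition combination (K : numFieldType) (V : lmodType K) (l : seq (K * V)) :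
  V := \sum_(p <- l) p.1 *: p.2.

(** * Schreier's space through its coordinates *)

(* Norms are K-valued; [rnorm] is the underlying real number, where [rho] is the
   identity of R or the embedding of R in R[i]. *)
Definition rnorm (R : realType) (K : numFieldType) (rho : R -> K)
  (V : normedZmodType K) (v : V) : R := xget 0 [set r | rho r = `|v|].

Section Schreier.
Variables (R : realType) (K : numFieldType) (rho : {rmorphism R -> K}).
Hypothesis rho_le : {mono rho : x y / x <= y}.
Hypothesis rho_real : forall x : K, x \is Num.real -> exists r, x = rho r.
Hypothesis rho_ultra : forall (U : set_system nat) (z : nat -> K) (M : R),
  UltraFilter U -> (forall n, `|z n| <= rho M) ->
  exists l, forall e, 0 < e -> U [set k | `|z k - l| < rho e].

Local Notation N := (rnorm rho).

Lemma rho_lt : {mono rho : x y / x < y}.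
Proof. exact: leW_mono. Qed.

Lemma rho_inj : injective rho.
Proof. exact: inc_inj. Qed.

Lemma rho_rnorm (V : normedZmodType K) (v : V) : rho (N v) = `|v|.
Proof.
have [r vr] := rho_real (normr_real v).
by rewrite /rnorm; case: xgetP => [r' _ //|/(_ r)]; rewrite /= -vr.
Qed.

Lemma rnorm_rho (r : R) : N (rho r) = `|r|.
Proof.
apply: rho_inj; rewrite rho_rnorm; have [r0|r0] := lerP 0 r.
  by rewrite !ger0_norm // -(rmorph0 rho) rho_le.
rewrite !ler0_norm ?rmorphN // ?ltW // -(rmorph0 rho).
by rewrite rho_lt.
Qed.

Section Norm.
Variable V : normedZmodType K.
Implicit Types u v w : V.

Lemma rnorm_ge0 v : 0 <= N v.
Proof. by rewrite -rho_le rmorph0 rho_rnorm. Qed.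

Lemma rnorm0 : N (0 : V) = 0.
Proof. by apply: rho_inj; rewrite rho_rnorm normr0 rmorph0. Qed.

Lemma rnormN v : N (- v) = N v.
Proof. by apply: rho_inj; rewrite !rho_rnorm normrN. Qed.

Lemma rdistC u v : N (u - v) = N (v - u).
Proof. by rewrite -rnormN opprB. Qed.

Lemma ler_rnormD u v : N (u + v) <= N u + N v.
Proof. by rewrite -rho_le rmorphD /= !rho_rnorm ler_normD. Qed.

Lemma ler_rnormB u v : N (u - v) <= N u + N v.
Proof. by rewrite (le_trans (ler_rnormD _ _)) // rnormN. Qed.

Lemma ler_rdistD w u v : N (u - v) <= N (u - w) + N (w - v).
Proof. by rewrite -(subrKA w) ler_rnormD. Qed.

Lemma lerB_rnormD u v : N u - N v <= N (u + v).
Proof. by rewrite -rho_le rmorphB /= !rho_rnorm lerB_normD. Qed.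

Lemma ler_rnorm_sum (I : Type) (s : seq I) (F : I -> V) :
  N (\sum_(i <- s) F i) <= \sum_(i <- s) N (F i).
Proof.
elim: s => [|i s IH]; first by rewrite !big_nil rnorm0.
by rewrite !big_cons (le_trans (ler_rnormD _ _)) // lerD2l.
Qed.

Lemma rnorm_eq0 v : N v <= 0 -> v = 0.
Proof.
move=> v0; apply/eqP; rewrite -normr_eq0 -rho_rnorm.
by rewrite (_ : N v = 0) ?rmorph0 //; apply/eqP; rewrite eq_le v0 rnorm_ge0.
Qed.

End Norm.

Lemma rnormM (a b : K) : N (a * b) = N a * N b.
Proof. by apply: rho_inj; rewrite rmorphM /= !rho_rnorm normrM. Qed.

Lemma rnormZ (V : normedModType K) (a : K) (v : V) : N (a *: v) = N a * N v.
Proof. by apply: rho_inj; rewrite rmorphM /= !rho_rnorm normrZ. Qed.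

Lemma rnorm_nat n : N (n%:R : K) = n%:R.
Proof. by rewrite -(rmorph_nat rho) rnorm_rho normr_nat. Qed.

Lemma rnorm_natV n : N (n%:R^-1 : K) = n%:R^-1.
Proof. by rewrite -(rmorph_nat rho) -fmorphV rnorm_rho ger0_norm. Qed.

Lemma cvg_rnormP (V : normedModType K) (u : nat -> V) (l : V) :
  u @ \oo --> l <->
  forall e, 0 < e -> \forall n \near \oo, N (u n - l) < e.
Proof.
split=> [ul e e0|ul].
  have : 0 < rho e by rewrite -(rmorph0 rho) rho_lt.
  move/cvgrPdist_lt: ul => /[apply]; apply: filterS => n.
  by rewrite distrC -rho_rnorm rho_lt.
apply/cvgrPdist_lt => eps eps0.
have [e epse] := rho_real (gtr0_real eps0).
have e0 : 0 < e by rewrite -rho_lt -epse rmorph0.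
apply: filterS (ul e e0) => n.
by rewrite epse distrC -rho_rnorm rho_lt.
Qed.

Lemma cvg_ex_rnorm (V : completeNormedModType K) (u : nat -> V) :
  (forall e, 0 < e -> exists n, forall m, (n <= m)%N -> N (u m - u n) < e) ->
  exists l, forall e, 0 < e -> \forall n \near \oo, N (u n - l) < e.
Proof.
move=> uc; suff /cvg_ex[l /cvg_rnormP ul] : cvg (u @ \oo) by exists l.
apply/cauchy_cvgP/cauchy_exP => eps eps0.
have [e epse] := rho_real (gtr0_real eps0).
have e0 : 0 < e by rewrite -rho_lt -epse rmorph0.
have [n un] := uc e e0; exists (u n); exists n => // m /un.
by rewrite -ball_normE /ball_ /= distrC -rho_rnorm epse rho_lt.
Qed.

(** * Sums over finite sets and the Schreier norm *)

(** The shift [j.-1] matches sets numbered from 1 with coordinates numbered from 0. *)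
Definition abs_sum (E : {fset nat}) (y : nat -> K) : R :=
  \sum_(j <- E) N (y j.-1).

Lemma eq_abs_sum E y z : y =1 z -> abs_sum E y = abs_sum E z.
Proof. by move=> yz; apply: eq_bigr => j _; rewrite yz. Qed.

Lemma abs_sumD E y z :
  abs_sum E (fun j => y j + z j) <= abs_sum E y + abs_sum E z.
Proof.
by rewrite -big_split /=; apply: ler_sum => j _; apply: ler_rnormD.
Qed.

Lemma abs_sum_fset1 j y : abs_sum [fset j.+1]%fset y = N (y j).
Proof. by rewrite /abs_sum big_seq_fset1. Qed.

Lemma abs_sum_sub (E F : {fset nat}) y z :
  (forall j, j \in E -> y j.-1 != 0 -> j \in F) ->
  (forall j, j \in F -> N (y j.-1) <= N (z j.-1)) ->
  abs_sum E y <= abs_sum F z.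
Proof.
move=> EF yz.
have -> : abs_sum E y = \sum_(j <- [seq j <- E | y j.-1 != 0]) N (y j.-1).
  rewrite big_filter [RHS]big_mkcond /=; apply: eq_bigr => j _.
  by case: ifPn => // /negPn/eqP ->; rewrite rnorm0.
apply: le_trans (_ : abs_sum F y <= _); last first.
  by rewrite /abs_sum !big_seq; apply: ler_sum.
set s := [seq j <- E | _].
have -> : \sum_(j <- s) N (y j.-1) = \sum_(j <- F | j \in s) N (y j.-1).
  rewrite -[RHS]big_filter; apply: perm_big; apply: uniq_perm => [||j].
  - exact: filter_uniq.
  - exact: filter_uniq.
  rewrite [RHS]mem_filter; case: (boolP (j \in s)) => //=.
  by rewrite mem_filter => /andP[y0 jE]; rewrite EF.
rewrite /abs_sum [leRHS](bigID (mem s)) /= lerDl.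
by apply: sumr_ge0 => j _; exact: rnorm_ge0.
Qed.

Lemma abs_sum_le_card (E : {fset nat}) y M :
  (forall j, j \in E -> N (y j.-1) <= M) -> abs_sum E y <= #|` E|%:R * M.
Proof.
have -> : #|` E|%:R * M = \sum_(j <- E) M.
  by rewrite big_const_seq count_predT iter_addr_0 mulr_natl.
by move=> yM; rewrite /abs_sum big_seq [leRHS]big_seq; apply: ler_sum.
Qed.

Lemma abs_sum_ge_card (E : {fset nat}) y M :
  (forall j, j \in E -> M <= N (y j.-1)) -> #|` E|%:R * M <= abs_sum E y.
Proof.
have -> : #|` E|%:R * M = \sum_(j <- E) M.
  by rewrite big_const_seq count_predT iter_addr_0 mulr_natl.
by move=> yM; rewrite /abs_sum big_seq [leRHS]big_seq; apply: ler_sum.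
Qed.

(** Brings [schreier_norm], a supremum taken in [K], down to a real supremum. *)
Lemma schreier_normE (c : c00 K) : exists s,
  [/\ schreier_norm c = rho s,
      forall E, admissible E -> abs_sum E c <= s &
      forall M, (forall E, admissible E -> abs_sum E c <= M) -> s <= M].
Proof.
pose X := [set abs_sum E c | E in [set E | admissible E]].
have X0 : X !=set0 by exists (abs_sum fset0 c), fset0.
have Xub : has_ubound X.
  have [n cn] := c00_bounded c.
  (* The sum over the whole support is a bound; the point 0 repeats the first coordinate, which is
     harmless here. *)
  exists (abs_sum [fset j in iota 0 n.+1]%fset c) => _ [E aE <-].
  apply: abs_sum_sub => // j jE.
  rewrite in_fset [_ \in _]mem_iota add0n ltnS leq0n andTb.
  case: j {jE} => //= j; apply: contraR; rewrite -leqNgt => jn.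
  by rewrite cn.
have rho_abs_sum E : rho (abs_sum E c) = \sum_(j <- E) `|c j.-1|.
  by rewrite rmorph_sum; apply: eq_bigr => j _; rewrite /= rho_rnorm.
exists (sup X); split; last 2 first.
- by move=> E aE; apply: ub_le_sup => //; exists E.
- by move=> M EM; apply: ge_sup => // _ [E aE <-]; exact: EM.
have XS : supremums (schreier_sums c) (rho (sup X)).
  split.
    move=> _ [E aE <-]; rewrite -rho_abs_sum rho_le.
    by apply: ub_le_sup => //; exists E.
  move=> b bub.
  (* An upper bound in [K] dominates the empty sum 0, hence is real, even over complex scalars. *)
  have b0 : 0 <= b by apply: bub; exists fset0; rewrite //= big_seq_fset0.
  have [r br] := rho_real (ger0_real b0).
  rewrite br rho_le; apply: ge_sup => // _ [E aE <-].
  by rewrite -rho_le -br rho_abs_sum; apply: bub; exists E.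
rewrite /schreier_norm /supremum ifF; last first.
  apply/negbTE/set0P; exists (\sum_(j <- fset0) `|c j.-1|).
  by exists fset0.
case: xgetP => [y _ ys|/(_ (rho (sup X)))//].
exact: is_subset1_supremums ys XS.
Qed.

Variables (S : completeNormedModType K) (emb : {linear c00 K -> S}).
Hypothesis hS : schreier_space emb.

Lemma abs_sum_le_emb (c : c00 K) E : admissible E -> abs_sum E c <= N (emb c).
Proof.
move=> aE; have [s [cs /(_ E aE) Es _]] := schreier_normE c.
by apply: le_trans Es _; rewrite -rho_le -cs rho_rnorm // (hS.1).
Qed.

Lemma rnorm_emb_le (c : c00 K) M :
  (forall E, admissible E -> abs_sum E c <= M) -> N (emb c) <= M.
Proof.
move=> EM; have [s [cs _ /(_ M EM) sM]] := schreier_normE c.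
by apply: le_trans sM; rewrite -rho_le -cs rho_rnorm // (hS.1).
Qed.

Lemma rnorm_coord_le_emb (c : c00 K) j : N (c j) <= N (emb c).
Proof. by rewrite -abs_sum_fset1 abs_sum_le_emb //; exact: admissible1. Qed.

Lemma emb_dense x e : 0 < e -> exists c, N (emb c - x) < e.
Proof.
move=> e0; have re0 : 0 < rho e by rewrite -(rmorph0 rho) rho_lt.
have [] := hS.2 (ball x (rho e))%R.
- by exists x; exact: ballxx.
- exact: ball_open.
move=> z [/= xc [c _ cE]]; exists c.
move: xc; rewrite -cE -ball_normE /ball_ /= distrC.
by rewrite -rho_rnorm rho_lt.
Qed.

(** Coordinates are 1-Lipschitz on c00 and so extend to the completion; the value at [x] is an
    ultrafilter limit along a sequence approximating [x]. By density the inequality determines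
    [co]. *)
Lemma coordinates :
  exists co : S -> nat -> K,
    forall x j (c : c00 K), N (c j - co x j) <= N (emb c - x).
Proof.
have [U [UU ooU]] := free_ultrafilter.
suff /choice[co coP] : forall x, exists y : nat -> K,
  forall j (c : c00 K), N (c j - y j) <= N (emb c - x) by exists co.
move=> x.
suff /choice[y yP] : forall j, exists yj : K,
  forall c : c00 K, N (c j - yj) <= N (emb c - x) by exists y.
move=> j.
have /choice[c cx] : forall n, exists c, N (emb c - x) < n.+1%:R^-1.
  by move=> n; apply: emb_dense; rewrite invr_gt0.
have cM n : `|c n j| <= rho (1 + N x).
  rewrite -rho_rnorm rho_le.
  rewrite (le_trans (rnorm_coord_le_emb _ _)) //.
  rewrite -{1}(subrK x (emb (c n))) (le_trans (ler_rnormD _ _)) //.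
  by rewrite lerD2r (le_trans (ltW (cx n))) // invf_le1 // ler1n.
have [l lP] := rho_ultra UU cM.
exists l => d; apply: (@le_addMeps _ _ _ 2) => // e e0.
have nearn : \forall n \near \oo, n.+1%:R^-1 < e.
  exact: near_infty_natSinv_lt (PosNum e0).
have [k /= [kl ke]] := filter_ex (filterI (lP e e0) (ooU _ nearn)).
rewrite (le_trans (ler_rdistD (c k j) _ _)) //.
have : N (c k j - l) < e by rewrite -rho_lt rho_rnorm.
have : N (d j - c k j) <= N (emb d - x) + N (emb (c k) - x).
  rewrite (rdistC (emb (c k))).
  apply: le_trans (ler_rdistD _ _ _) => //.
  by rewrite -linearB; exact: (rnorm_coord_le_emb (d - c k)).
have := lt_trans (cx k) ke.
lra.
Qed.

Variable co : S -> nat -> K.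
Hypothesis co_approx :
  forall x j (c : c00 K), N (c j - co x j) <= N (emb c - x).

(** Linearity is read off from approximants in c00; the factor 2 in the constant comes from
    comparing both sides with them. *)
Lemma coordP a x y j : co (a *: x + y) j = a * co x j + co y j.
Proof.
apply/eqP; rewrite -subr_eq0; apply/eqP/rnorm_eq0.
apply: (@le_addMeps _ _ _ (2 * (N a + 1))).
  by rewrite mulr_ge0 // addr_ge0 // rnorm_ge0.
move=> e e0; rewrite add0r.
have [c cx] := emb_dense x e0; have [d dy] := emb_dense y e0.
have := co_approx (a *: x + y) j (a *: c + d).
have -> : (a *: c + d) j = a * c j + d j by [].
rewrite linearP (_ : _ + _ - (_ + _) = a *: (emb c - x) + (emb d - y));
  last by rewrite scalerBr addrACA opprD.
have := ler_rnormD (a *: (emb c - x)) (emb d - y).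
rewrite rnormZ // => H1 H2.
have H3 := ler_rdistD (a * c j + d j) (co (a *: x + y) j)
  (a * co x j + co y j).
rewrite (rdistC (co _ _) (a * c j + d j)) in H3.
rewrite (_ : _ + _ - (_ + _) = a * (c j - co x j) + (d j - co y j)) in H3;
  last by ring.
have := ler_rnormD (a * (c j - co x j)) (d j - co y j).
rewrite rnormM // => H4.
have aN := rnorm_ge0 a.
have := ler_wpM2l aN (le_trans (co_approx x j c) (ltW cx)).
have := ler_wpM2l aN (ltW cx).
have := co_approx y j d.
lra.
Qed.

(** Summing [co_approx] would cost a factor equal to the size of [E]; with a second approximant [d]
    of [x], only an arbitrarily small error pays it. *)
Lemma abs_sum_approx x (c : c00 K) E : admissible E ->
  abs_sum E (fun j => c j - co x j) <= N (emb c - x).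
Proof.
move=> aE; apply: (@le_addMeps _ _ _ (1 + #|` E|%:R)) => // e e0.
have [d dx] := emb_dense x e0.
rewrite (eq_abs_sum _ (z := fun j => (c - d) j + (d j - co x j))); last first.
  by move=> j; rewrite [(c - d) j](_ : _ = c j - d j) // subrKA.
rewrite (le_trans (abs_sumD _ _ _)) //.
have := abs_sum_le_emb (c - d) aE; rewrite linearB /=.
have := ler_rdistD x (emb c) (emb d).
rewrite (rdistC x (emb d)).
have : abs_sum E (fun j => d j - co x j) <= #|` E|%:R * e.
  apply: abs_sum_le_card => j _.
  exact: le_trans (co_approx x _ d) (ltW dx).
rewrite mulrDl mul1r; lra.
Qed.

Lemma abs_sum_coord_le x E : admissible E -> abs_sum E (co x) <= N x.
Proof.
move=> aE; have := abs_sum_approx x 0 aE.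
rewrite linear0 sub0r rnormN //; apply: le_trans.
apply: abs_sum_sub => // j _.
by rewrite [(0 : c00 K) j.-1](_ : _ = 0) // sub0r rnormN.
Qed.

(** With [abs_sum_coord_le], this extends the Schreier formula for the norm from c00 to S. *)
Lemma rnorm_le x M :
  (forall E, admissible E -> abs_sum E (co x) <= M) -> N x <= M.
Proof.
move=> EM; apply: (@le_addMeps _ _ _ 2) => // e e0.
have [c cx] := emb_dense x e0.
have : N (emb c) <= e + M.
  apply: rnorm_emb_le => E aE.
  rewrite (eq_abs_sum _ (z := fun j => (c j - co x j) + co x j)); last first.
    by move=> j; rewrite subrK.
  rewrite (le_trans (abs_sumD _ _ _)) // lerD ?EM //.
  exact: le_trans (abs_sum_approx _ _ aE) (ltW cx).
have := ler_rdistD (emb c) x 0.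
by rewrite !subr0 (rdistC x); lra.
Qed.

Lemma coord_tail x e : 0 < e -> exists n, forall E, admissible E ->
  (forall j, j \in E -> (n < j)%N) -> abs_sum E (co x) <= e.
Proof.
move=> e0; have [c cx] := emb_dense x e0; have [n cn] := c00_bounded c.
exists n => E aE nE; apply: le_trans (ltW cx).
apply: le_trans (abs_sum_approx x c aE).
apply: abs_sum_sub => // j /nE; case: j => //= j nj.
by rewrite cn // sub0r rnormN.
Qed.

(** The truncations of [y] form a Cauchy sequence. With [coord_tail], this describes the range of
    [co]. *)
Lemma coord_onto (y : nat -> K) :
  (forall e, 0 < e -> exists n, forall E, admissible E ->
     (forall j, j \in E -> (n < j)%N) -> abs_sum E y <= e) ->
  exists x, co x =1 y.
Proof.
move=> ytail.
have tfin n : (fun j => if (j < n)%N then y j else 0) \in @finitely_supported K.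
  apply/asboolP; apply: (@sub_finite_set _ _ `I_n) => // j /=.
  by case: ifP; rewrite ?eqxx.
pose t n := C00 (tfin n).
have [x tx] : exists l, forall e, 0 < e ->
    \forall n \near \oo, N (emb (t n) - l) < e.
  apply: cvg_ex_rnorm => // e e0.
  have [n ye] := ytail (e / 2) (divr_gt0 e0 (ltr0Sn _ 1)).
  exists n => m nm; rewrite -linearB.
  apply: le_lt_trans (_ : e / 2 < e); last by lra.
  apply: rnorm_emb_le => E aE.
  (* Only the part of [E] beyond [n] sees the difference of the truncations, and it is again
     admissible. *)
  pose F := [fset j in E | (n < j)%N]%fset.
  have FE : (F `<=` E)%fset by apply/fsubsetP => j; rewrite !inE => /andP[].
  apply: le_trans (ye F (admissible_sub FE aE) _); last first.
    by move=> j; rewrite !inE => /andP[].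
  apply: abs_sum_sub => [j jE|j _].
    rewrite [(t m - t n) _](_ : _ = t m j.-1 - t n j.-1) //= !inE jE /=.
    have := admissible_gt0 aE jE; case: j {jE} => // j _ /=.
    apply: contraR; rewrite -leqNgt => jn.
    by rewrite (leq_trans jn) // jn subrr.
  rewrite [(t m - t n) _](_ : _ = t m j.-1 - t n j.-1) //=.
  case: ifP => jm; case: ifP => jn; rewrite ?subrr ?subr0 ?sub0r ?rnormN //;
    rewrite ?rnorm0 ?rnorm_ge0 //.
exists x => j; apply/eqP; rewrite eq_sym -subr_eq0; apply/eqP.
apply: rnorm_eq0.
apply/ler_addgt0Pr => e e0; rewrite add0r.
have [n [/= jn tn]] := filter_ex (filterI (nbhs_infty_gt j) (tx e e0)).
apply: le_trans (ltW tn).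
by have := co_approx x j (t n); rewrite /= jn.
Qed.

Lemma coordB x y j : co (x - y) j = co x j - co y j.
Proof. by rewrite addrC -scaleN1r coordP mulN1r addrC. Qed.

Lemma coord0 j : co 0 j = 0.
Proof. by rewrite -(subrr 0) coordB subrr. Qed.

Lemma coordZ a x j : co (a *: x) j = a * co x j.
Proof. by rewrite -[_ *: _]addr0 coordP coord0 addr0. Qed.

Lemma coordD x y j : co (x + y) j = co x j + co y j.
Proof. by rewrite -[x in LHS]scale1r coordP mul1r. Qed.

Lemma coord_sum (I : Type) (s : seq I) (F : I -> S) j :
  co (\sum_(i <- s) F i) j = \sum_(i <- s) co (F i) j.
Proof.
elim: s => [|i s IH]; first by rewrite !big_nil coord0.
by rewrite !big_cons coordD IH.
Qed.

Lemma rnorm_coord_le x j : N (co x j) <= N x.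
Proof. by rewrite -abs_sum_fset1 abs_sum_coord_le //; exact: admissible1. Qed.

Lemma coord_small x e : 0 < e ->
  exists n, forall j, (n <= j)%N -> N (co x j) <= e.
Proof.
move=> e0; have [n nx] := coord_tail x e0; exists n => j nj.
rewrite -abs_sum_fset1 nx //; first exact: admissible1.
by move=> i; rewrite in_fset1 => /eqP ->.
Qed.

(** * Coordinatewise convergence and arithmetic means *)

(** The limit [y] is any scalar sequence; whether it comes from S is the matter of
    [coord_closed]. *)
Definition coord_cvg (u : nat -> S) (y : nat -> K) := forall j e, 0 < e ->
  \forall n \near \oo, N (co (u n) j - y j) < e.

Lemma coord_cvg_homo u y (phi : nat -> nat) :
  {homo phi : m n / (m < n)%N} -> coord_cvg u y -> coord_cvg (u \o phi) y.
Proof. by move=> hphi uy j e e0; exact: near_homo hphi (uy j e e0). Qed.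

Lemma cesaro_rnorm (V : normedModType K) (z : nat -> V) (l : V) :
  (forall e, 0 < e -> \forall n \near \oo, N (z n - l) < e) ->
  forall e, 0 < e -> \forall n \near \oo, N (arith_mean z n - l) < e.
Proof.
move=> zl e e0.
have /cesaro : (fun n => N (z n - l)) @ \oo --> (0 : R).
  apply/cvgrPdist_lt => d d0; apply: filterS (zl d d0) => n.
  by rewrite sub0r normrN ger0_norm ?rnorm_ge0.
move=> /cvgrPdist_lt/(_ e e0); apply: filterS => n.
rewrite sub0r normrN; apply: le_lt_trans; apply: le_trans (ler_norm _).
rewrite /arithmetic_mean /series /= big_mkord.
rewrite arith_meanB rnormZ // rnorm_natV // ler_wpM2l ?invr_ge0 //.
exact: ler_rnorm_sum.
Qed.

Lemma coord_mean (u : nat -> S) n j :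
  co (arith_mean u n) j = n.+1%:R^-1 * \sum_(i < n.+1) co (u i) j.
Proof. by rewrite coordZ coord_sum. Qed.

(** In each coordinate the means tend to [y j] by Cesaro and to [co x j] by continuity. *)
Lemma coord_mean_cvg (u : nat -> S) y x : coord_cvg u y ->
  (forall e, 0 < e -> \forall n \near \oo, N (arith_mean u n - x) < e) ->
  co x =1 y.
Proof.
move=> uy ux j; apply/eqP; rewrite -subr_eq0; apply/eqP.
apply: rnorm_eq0.
apply: (@le_addMeps _ _ _ 2) => // e e0; rewrite add0r.
have my := @cesaro_rnorm K^o (fun n => co (u n) j) (y j) (uy j) e e0.
have [n [mnx mny]] := filter_ex (filterI (ux e e0) my).
have := ler_rdistD (co (arith_mean u n) j) (co x j) (y j).
have := rnorm_coord_le (arith_mean u n - x) j.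
rewrite coordB (rdistC _ (co x j)).
have : N (co (arith_mean u n) j - y j) < e by rewrite coord_mean; exact: mny.
lra.
Qed.

(** Limits along one ultrafilter serve all coordinates at once, so no nested subsequences are
    extracted. *)
Lemma coord_cvg_subseq (u : nat -> S) M : (forall n, N (u n) <= M) ->
  exists2 phi : nat -> nat, {homo phi : m n / (m < n)%N} &
  exists y, coord_cvg (u \o phi) y.
Proof.
move=> uM; have [U [UU ooU]] := free_ultrafilter.
have /choice[y yP] : forall j, exists l,
    forall e, 0 < e -> U [set k | `|co (u k) j - l| < rho e].
  move=> j; apply: (rho_ultra (M := M)) => n.
  by rewrite -rho_rnorm rho_le (le_trans (rnorm_coord_le _ _)).
have /choice[g gP] : forall mp : nat * nat, exists n, (mp.2 < n)%N /\
    forall j, (j < mp.1)%N -> N (co (u n) j - y j) < mp.1.+1%:R^-1.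
  move=> [m p] /=.
  have Um : U [set k | forall j, (j < m)%N ->
      N (co (u k) j - y j) < m.+1%:R^-1].
    have e0 : 0 < (m.+1%:R^-1 : R) by rewrite invr_gt0.
    (* Freeing the tolerance from [m] lets the induction on the number of coordinates go through. *)
    move: (m.+1%:R^-1) e0 => e e0.
    elim: m => [|m IH].
      by apply: filterS (@filterT _ U _) => k _ j.
    apply: filterS (filterI IH (yP m e e0)) => k /= [km].
    rewrite -rho_rnorm rho_lt // => ke j.
    by rewrite ltnS leq_eqVlt => /predU1P[->//|]; exact: km.
  have [n [nP np]] := filter_ex (filterI Um (ooU _ (nbhs_infty_gt p))).
  by exists n.
pose phi := fix phi k := if k is k'.+1 then g (k', phi k') else 0%N.
have incr k : (phi k < phi k.+1)%N by have [] := gP (k, phi k).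
exists phi; first by apply: homo_ltn => // b a c; exact: ltn_trans.
exists y => j e e0.
have [n _ nP] := near_infty_natSinv_lt (PosNum e0).
exists (maxn n j).+2 => // -[//|k] /=; rewrite ltnS => nk.
have [_ /(_ j) kj] := gP (k, phi k).
apply: lt_trans (kj _) _ => /=.
  by rewrite (leq_trans _ nk) // ltnS leq_maxr.
by apply: nP; rewrite /= (leq_trans _ (ltnW nk)) // leq_maxl.
Qed.

(** * Necessary conditions for a Banach-Saks set *)

Lemma banach_saks_bounded (A : set S) : banach_saks A ->
  exists M, forall a, A a -> N a <= M.
Proof.
move=> bsA; apply: contrapT => /forallNP Aunb.
have /choice[u uP] : forall n, exists a, A a /\ n.+1%:R < N a.
  move=> n; have /existsNP[a /not_implyP[Aa]] := Aunb n.+1%:R.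
  by move=> /negP; rewrite -ltNge => aM; exists a.
(* Convergent means force u (phi n) = o(n). *)
have [phi hphi /cvg_ex[x /cvg_rnormP mx]] := bsA u (fun n => (uP n).1).
have e0 : 0 < 4^-1 :> R by [].
have [n0 _ n0P] := mx _ e0.
pose C := N x + 4^-1.
(* [C] bounds the means from [n0] on; for [n] beyond [2 * C], the bound [n.+2%:R / 2 + C] on the
   term [u (phi n.+1)] stays below [n.+2%:R]. *)
have [n [/= n0n nC]] : exists n, (n0 <= n)%N /\ 2 * C < n%:R :> R.
  have [n [/= n0n nC]] := filter_ex (filterI (nbhs_infty_ge n0)
    (nbhs_infty_gtr (2 * C))).
  by exists n.
set m := arith_mean (u \o phi) in n0P mx.
have mn := n0P n n0n; have mSn := n0P n.+1 (leqW n0n).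
have uE : u (phi n.+1) = n.+2%:R *: (m n.+1 - m n) + m n.
  rewrite scalerBr -addrA -[X in - _ + X]scale1r -scaleNr -scalerDl.
  rewrite /m /arith_mean scalerA divff ?pnatr_eq0 // scale1r.
  rewrite -(natr1 n.+1) opprD subrK scaleNr scalerA divff ?pnatr_eq0 //.
  by rewrite scale1r big_ord_recr /= addrC addKr.
have := (uP (phi n.+1)).2.
apply/negP; rewrite -leNgt uE.
rewrite (le_trans (ler_rnormD _ _)) // rnormZ // rnorm_nat //.
apply: le_trans (_ : n.+2%:R <= _); last first.
  by rewrite ler_nat ltnS; exact: homo_ltn_ge.
have H1 := ler_rdistD x (m n.+1) (m n).
rewrite (rdistC x) in H1.
have H2 : N (m n.+1 - m n) <= 2^-1 by lra.
have H3 := ler_rdistD x (m n) 0.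
rewrite !subr0 in H3.
have n20 : 0 <= n.+2%:R :> R by [].
have H4 := ler_wpM2l n20 H2.
have H5 : n%:R <= n.+2%:R :> R by rewrite ler_nat leqW.
rewrite /C in nC; lra.
Qed.

(** The limit of the means has coordinates [y], so coordinatewise limits of sequences in [A] lie in
    S: this is condition (3). *)
Lemma banach_saks_coord_cvg (A : set S) (u : nat -> S) y : banach_saks A ->
  (forall n, A (u n)) -> coord_cvg u y ->
  exists2 chi : nat -> nat, {homo chi : m n / (m < n)%N} &
  exists2 x, co x =1 y & forall e, 0 < e ->
    \forall n \near \oo, N (arith_mean (u \o chi) n - x) < e.
Proof.
move=> bsA uA uy; have [chi hchi] := bsA u uA.
move=> /cvg_ex[x /cvg_rnormP mx].
exists chi => //; exists x => //.
by apply: coord_mean_cvg mx; exact: coord_cvg_homo.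
Qed.

(* If the tails are not uniformly small, a subsequence minus its limit has
   nearly disjoint bumps of height e / 2 at places I; the last p of its first
   2p terms have their bumps on an admissible set, which keeps the Schreier norm
   of the mean away from 0. *)
Lemma banach_saks_unif_tail (A : set S) : banach_saks A ->
  forall e, 0 < e -> exists n, forall a, A a ->
    forall j, (n <= j)%N -> N (co a j) <= e.
Proof.
move=> bsA e e0; have [M AM] := banach_saks_bounded bsA.
apply: contrapT => /forallNP Atail.
have /choice[aJ aJP] : forall n, exists aj : S * nat,
    [/\ A aj.1, (n <= aj.2)%N & e < N (co aj.1 aj.2)].
  move=> n; have /existsNP[a /not_implyP[Aa /existsNP[j]]] := Atail n.
  by move=> /not_implyP[nj /negP]; rewrite -ltNge => ej; exists (a, j).
have [phi1 hphi1 [y ay]] : exists2 phi : nat -> nat,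
    {homo phi : m n / (m < n)%N} & exists y, coord_cvg ((fst \o aJ) \o phi) y.
  by apply: (@coord_cvg_subseq _ M) => n; apply: AM; case: (aJP n).
set a := (fst \o aJ) \o phi1 in ay; pose I := (snd \o aJ) \o phi1.
have Aa n : A (a n) by case: (aJP (phi1 n)).
have nI n : (n <= I n)%N.
  by have [_ + _] := aJP (phi1 n); apply: leq_trans; exact: homo_ltn_ge.
have ea n : e < N (co (a n) (I n)) by case: (aJP (phi1 n)).
(* This first use of the hypothesis only places [y] in S; the second one concerns the sparse
   subsequence. *)
have [_ _ [x0 x0y _]] := banach_saks_coord_cvg bsA Aa ay.
pose b n := a n - x0.
have b0 j d : 0 < d -> \forall n \near \oo, N (co (b n) j) < d.
  move=> d0; apply: filterS (ay j d d0) => n.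
  by rewrite /b coordB x0y.
have e2 : 0 < e / 2 by rewrite divr_gt0.
have [n0 x0n0] := coord_small x0 e2.
(* These bounds sum to at most [e / 8], a quarter of the bump height [e / 2]. *)
pose c k : R := e / 16 * 2^-1 ^+ k.
have c0 k : 0 < c k by rewrite mulr_gt0 ?divr_gt0 // exprn_gt0 // invr_gt0.
have c_le k l : (k <= l)%N -> c l <= c k.
  move=> kl; rewrite ler_pM2l ?divr_gt0 // ler_wiXn2l // invf_le1 //.
  by rewrite ler1n.
(* Each new term is small at the old places and each old term at the new place. Starting from [n0]
   keeps [x0] at most [e / 2] at all of them. *)
have [|psi [hpsi psin0 psiP]] := @sparse_subsequence (fun k m n =>
  [/\ N (co (b n) (I m)) <= c k, N (co (b m) (I n)) <= c k & (I m < I n)%N]) n0.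
  move=> k m; have [n1 bm] := coord_small (b m) (c0 k).
  near=> n; split.
  - by apply: ltW; near: n; exact: b0.
  - by apply: bm; apply: leq_trans (nI n); near: n; exact: nbhs_infty_ge.
  - by apply: leq_trans (nI n); near: n; exact: nbhs_infty_gt.
have aPsi : coord_cvg (a \o psi) y by exact: coord_cvg_homo.
have [chi hchi [x xy mx]] :=
  banach_saks_coord_cvg bsA (fun n => Aa (psi n)) aPsi.
pose g := psi \o chi.
have chi_inj : injective chi.
  by move=> i l il; case: (ltngtP i l) => // /hchi; rewrite il ltnn.
(* In either order the bound is indexed by the term [i], so it can be summed over the terms at a
   fixed place. *)
have gI i l : i != l -> N (co (b (g i)) (I (g l))) <= c i.
  rewrite -(inj_eq chi_inj) neq_ltn => /orP[il|li].
    have [_ + _] := psiP _ _ il; move=> /le_trans; apply.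
    by apply: c_le; exact: leq_trans (homo_ltn_ge hchi i) (ltnW il).
  have [+ _ _] := psiP _ _ li; move=> /le_trans; apply.
  by apply: c_le; exact: homo_ltn_ge.
have gIl l : e / 2 <= N (co (b (g l)) (I (g l))).
  have := ea (g l); have := x0n0 (I (g l)) (leq_trans (psin0 _) (nI _)).
  have := lerB_rnormD (co (a (g l)) (I (g l)))
    (- co x0 (I (g l))).
  by rewrite rnormN // /b coordB; lra.
have Ig_inj : injective (fun l => (I (g l)).+1).
  move=> i l [il]; apply/eqP; apply: contraT => /gI.
  rewrite -il; have := gIl i; have := c_le 0%N i (leq0n _).
  by rewrite /c expr0; lra.
have e16 : 0 < e / 16 by rewrite divr_gt0.
have [n1 _ n1P] := mx _ e16.
pose p := n1.+1.
pose E := seq_fset tt [seq (I (g l)).+1 | l <- iota p p].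
have cardE : #|` E| = p.
  rewrite size_seq_fset undup_id ?size_map ?size_iota //.
  by rewrite map_inj_uniq ?iota_uniq.
have aE : admissible E.
  move=> _ /[!seq_fsetE] /mapP[l + ->]; rewrite mem_iota cardE => /andP[pl _].
  apply: leqW; apply: leq_trans (nI _); apply: leq_trans pl _.
  exact: leq_trans (homo_ltn_ge hchi _) (homo_ltn_ge hpsi _).
set mn := arith_mean (a \o psi \o chi) (p + p).-1.
have mn_small : N (mn - x) < e / 16 by apply: n1P; rewrite /p addSn /= leq_addr.
have := abs_sum_coord_le (mn - x) aE.
apply/negP; rewrite -ltNge; apply: lt_le_trans mn_small _.
have pp0 : 0 < (p + p)%:R :> R by rewrite ltr0n.
(* At each place the modulus is at least [(e / 2 - e / 8) / (p + p)]; the [p] places of [E] give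
   [3 / 16 * e], more than [e / 16]. *)
apply: le_trans (abs_sum_ge_card (M := (p + p)%:R^-1 * (3 / 8 * e)) _).
  have -> : #|` E|%:R * ((p + p)%:R^-1 * (3 / 8 * e)) = 3 / 16 * e.
    by rewrite cardE natrD; field; rewrite -natrD pnatr_eq0.
  by lra.
move=> _ /[!seq_fsetE] /mapP[l + ->] /=; rewrite mem_iota => /andP[_ lpp].
rewrite coordB coord_mean.
have -> : (p + p).-1.+1 = (p + p)%N by [].
rewrite (_ : _ - _ = (p + p)%:R^-1 *
    \sum_(i < p + p) co (b (g i)) (I (g l))); last first.
  under [in RHS]eq_bigr do rewrite /b coordB.
  rewrite sumrB sumr_const card_ord mulrBr -[co x0 _ *+ _]mulr_natl mulrA.
  by rewrite mulVf ?pnatr_eq0 // mul1r xy x0y.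
rewrite rnormM // rnorm_natV // ler_pM2l ?invr_gt0 //.
rewrite (bigD1 (Ordinal lpp)) //=.
apply: le_trans (lerB_rnormD _ _).
have := gIl l.
have : N (\sum_(i < p + p | i != Ordinal lpp) co (b (g i)) (I (g l))) <= e / 8.
  apply: le_trans (_ : \sum_(i < p + p) c i <= _).
    rewrite -big_filter (le_trans (ler_rnorm_sum _ _)) //.
    rewrite big_filter [leRHS](bigID (fun i => i != Ordinal lpp)) /=.
    apply: ler_wpDr; first by apply: sumr_ge0 => i _; exact: ltW.
    by apply: ler_sum => i il; exact: gI.
  rewrite /c -mulr_sumr; have := sum_half_le2 R (p + p).
  by move=> /(ler_wpM2l (ltW e16)); lra.
lra.
Unshelve. all: by end_near. Qed.

(** * The absolutely convex hull *)

Definition absconvex_combinations (A : set S) : set S :=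
  [set combination l | l in
     [set l : seq (K * S) | (forall p, p \in l -> A p.2) /\
                            \sum_(p <- l) N p.1 <= 1]].

(** A concrete set containing the hull, on which estimates reduce to finite combinations. *)
Definition absconvex_approx (A : set S) : set S :=
  [set x | forall e, 0 < e ->
     exists2 z, absconvex_combinations A z & N (x - z) < e].

Lemma closed_absconvex_approx A : closed (absconvex_approx A).
Proof.
move=> x clx e e0.
have e2 : 0 < e / 2 by rewrite divr_gt0.
have re2 : 0 < rho (e / 2) by rewrite -(rmorph0 rho) rho_lt.
have [y [/(_ _ e2)[z Az yz] xy]] := clx _ (nbhsx_ballx x (rho (e / 2)) re2).
exists z => //; move: xy; rewrite -ball_normE /ball_ /= -rho_rnorm.
by rewrite rho_lt // => xy; have := ler_rdistD y x z; lra.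
Qed.

Lemma absolutely_convex_approx A : absolutely_convex (absconvex_approx A).
Proof.
move=> x y a b Dx Dy ab1 e e0.
have {}ab1 : N a + N b <= 1.
  by rewrite -rho_le rmorphD rmorph1 /= !rho_rnorm.
have [a0 b0] := (rnorm_ge0 a, rnorm_ge0 b).
have e2 : 0 < e / 2 by rewrite divr_gt0.
have [_ [lx [lxA lx1] <-] xl] := Dx _ e2.
have [_ [ly [lyA ly1] <-] yl] := Dy _ e2.
pose scale c (l : seq (K * S)) := [seq (c * p.1, p.2) | p <- l].
have combZ c l : combination (scale c l) = c *: combination l.
  rewrite /combination big_map scaler_sumr.
  by apply: eq_bigr => p _; rewrite scalerA.
have wtZ c l : \sum_(p <- scale c l) N p.1 = N c * \sum_(p <- l) N p.1.
  by rewrite big_map mulr_sumr; apply: eq_bigr => p _; rewrite rnormM.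
exists (a *: combination lx + b *: combination ly).
  exists (scale a lx ++ scale b ly); last first.
    by rewrite /combination big_cat /= -!combZ.
  split=> [p|].
    by rewrite mem_cat => /orP[] /mapP[q ql ->] /=; [exact: lxA|exact: lyA].
  rewrite big_cat /= !wtZ; apply: le_trans ab1.
  by rewrite lerD // ler_piMr.
rewrite opprD addrACA -!scalerBr.
apply: le_lt_trans (ler_rnormD _ _) _; rewrite !rnormZ //.
have := ler_wpM2l a0 (ltW xl); have := ler_wpM2l b0 (ltW yl).
have : (N a + N b) * (e / 2) <= 1 * (e / 2) by rewrite ler_wpM2r // ltW.
lra.
Qed.

Lemma absconvex_closed_hull_approx A :
  absconvex_closed_hull A `<=` absconvex_approx A.
Proof.
apply: smallest_sub.
  by split; [exact: closed_absconvex_approx|exact: absolutely_convex_approx].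
move=> x Ax e e0; exists x; last by rewrite subrr rnorm0.
exists [:: (1, x)]; last by rewrite /combination big_seq1 scale1r.
split=> [p|]; first by rewrite mem_seq1 => /eqP ->.
by rewrite big_seq1 /= -[1]/(1%:R) rnorm_nat.
Qed.

Lemma seminorm_combination (q : S -> R) (l : seq (K * S)) :
  q 0 <= 0 -> (forall x y, q (x + y) <= q x + q y) ->
  (forall a x, q (a *: x) <= N a * q x) ->
  q (combination l) <= \sum_(p <- l) N p.1 * q p.2.
Proof.
move=> q0 qD qZ; rewrite /combination.
elim: l => [|p l IH]; first by rewrite !big_nil.
by rewrite !big_cons (le_trans (qD _ _)) // lerD.
Qed.

(** Passes conditions (1) and (2) to the hull, with [q] the norm or the modulus of a coordinate. *)
Lemma seminorm_approx_le (A : set S) (q : S -> R) (M : R) : 0 <= M ->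
  q 0 <= 0 -> (forall x y, q (x + y) <= q x + q y) ->
  (forall a x, q (a *: x) <= N a * q x) -> (forall x, q x <= N x) ->
  (forall a, A a -> q a <= M) -> forall x, absconvex_approx A x -> q x <= M.
Proof.
move=> M0 q0 qD qZ qN AM x Dx; apply/ler_addgt0Pr => e e0.
have [_ [l [lA l1] <-] xl] := Dx e e0.
rewrite -(subrK (combination l) x) (le_trans (qD _ _)) // addrC lerD //.
  2: by rewrite (le_trans (qN _)) // ltW.
apply: le_trans (seminorm_combination l q0 qD qZ) _.
apply: le_trans (_ : (\sum_(p <- l) N p.1) * M <= _); last first.
  by rewrite ler_piMl.
rewrite mulr_suml big_seq [leRHS]big_seq; apply: ler_sum => p pl.
by apply: ler_wpM2l; [exact: rnorm_ge0|exact: AM (lA _ pl)].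
Qed.

(** For bounded sets this amounts to condition (3), as [coord_cvg_subseq] supplies the
    subsequence. *)
Definition coord_closed (A : set S) := forall u y,
  (forall n, A (u n)) -> coord_cvg u y -> exists x, co x =1 y.

Lemma coord_cvg_abs_sum (u : nat -> S) y E d : coord_cvg u y -> 0 < d ->
  \forall n \near \oo, abs_sum E (fun j => co (u n) j - y j) < d.
Proof.
move=> uy d0; have c0 : 0 < #|` E|.+1%:R :> R by rewrite ltr0n.
have uyE j : \forall n \near \oo,
    N (co (u n) j.-1 - y j.-1) < d / #|` E|.+1%:R.
  by apply: uy; rewrite divr_gt0.
apply: filterS (near_all_seq E uyE) => n uyn.
apply: le_lt_trans (abs_sum_le_card (M := d / #|` E|.+1%:R) _) _.
  by move=> j jE; apply: ltW; exact: uyn.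
by rewrite mulrCA gtr_pMr // ltr_pdivrMr // mul1r ltr_nat.
Qed.

Lemma abs_sum_coordD E x y :
  abs_sum E (co (x + y)) <= abs_sum E (co x) + abs_sum E (co y).
Proof.
apply: le_trans (abs_sumD _ _ _).
by rewrite (eq_abs_sum _ (coordD x y)).
Qed.

Lemma abs_sum_coordZ E a x : abs_sum E (co (a *: x)) <= N a * abs_sum E (co x).
Proof.
rewrite (eq_abs_sum _ (coordZ a x)) mulr_sumr.
by apply: ler_sum => j _; rewrite rnormM.
Qed.

Lemma abs_sum_coord0 E : abs_sum E (co 0) <= 0.
Proof.
rewrite (eq_abs_sum _ coord0); apply: sumr_le0 => j _.
by rewrite rnorm0.
Qed.

(* An instance of Krein's theorem: if the limit y had mass e on far away sets
   E_0, E_1, ..., then the combinations approximating u would give mass at least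
   e / (4 M) to each W i, so that some sequence in A would have a limit with
   mass e / 4 on infinitely many E_i. *)
Lemma coord_closed_hull (A : set S) M0 : (forall a, A a -> N a <= M0) ->
  coord_closed A -> coord_closed (absconvex_approx A).
Proof.
move=> AM0 clA u y Du uy; apply: coord_onto => e e0.
have [M M_gt0 AM] : exists2 M, 0 < M & forall a, A a -> N a <= M.
  exists (Num.max M0 1); first by rewrite lt_max ltr01 orbT.
  by move=> a /AM0 aM; rewrite le_max aM.
apply: contrapT => /forallNP ytail.
have /choice[E EP] : forall n, exists E : {fset nat},
    [/\ admissible E, forall j, j \in E -> (n < j)%N & e < abs_sum E y].
  move=> n; have /existsNP[E /not_implyP[aE /not_implyP[nE]]] := ytail n.
  by move=> /negP; rewrite -ltNge => eE; exists E.
have e4 : 0 < e / 4 by rewrite divr_gt0.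
(* Of the mass above [e], less than [e / 4] is lost from [y] to [u n] and again from [u n] to the
   combination. *)
have /choice[l lP] : forall k, exists l : seq (K * S),
    [/\ forall p, p \in l -> A p.2, \sum_(p <- l) N p.1 <= 1 &
        forall i, (i <= k)%N -> e / 2 < abs_sum (E i) (co (combination l))].
  move=> k.
  have [n uyn] := filter_ex (near_all_seq (iota 0 k.+1)
    (fun i => coord_cvg_abs_sum (E i) uy e4)).
  have [_ [l [lA l1] <-] unl] := Du n _ e4.
  exists l; split=> // i ik.
  have [aE _ eE] := EP i.
  have uyi : abs_sum (E i) (fun j => co (u n) j - y j) < e / 4.
    by apply: uyn; rewrite mem_iota.
  have := abs_sum_coord_le (u n - combination l) aE.
  have : abs_sum (E i) y <= abs_sum (E i) (fun j => co (u n) j - y j) +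
      abs_sum (E i) (co (u n - combination l)) +
      abs_sum (E i) (co (combination l)).
    rewrite -addrA; apply: (@le_trans _ _ (abs_sum (E i) (fun j =>
      (y j - co (u n) j) + co (u n) j))).
      by rewrite (eq_abs_sum _ (z := y)) // => j; rewrite subrK.
    apply: le_trans (abs_sumD _ _ _) _; apply: lerD.
      by apply: ler_sum => j _; rewrite rdistC.
    by apply: le_trans (abs_sum_coordD _ _ _); rewrite subrK.
  lra.
pose W i := [set a | A a /\ e / 4 <= abs_sum (E i) (co a)].
(* The discrete measure on S given by the moduli of the coefficients of the [k]-th combination. *)
pose lam k (X : set S) : R := \sum_(p <- l k) N p.1 * (p.2 \in X)%:R.
have [iota [hiota iotaP]] : exists iota : nat -> nat,
    {homo iota : m n / (m < n)%N} /\
    forall n, exists a, forall m, (m <= n)%N -> W (iota m) a.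
  apply: (@large_intersections R S lam W (e / 4 / M)).
  - by move=> k X; apply: sumr_ge0 => p _; rewrite mulr_ge0 // rnorm_ge0.
  - by move=> k; rewrite /lam big1 // => p _; rewrite in_set0 mulr0.
  - move=> k X; have [_ l1 _] := lP k; apply: le_trans l1.
    apply: ler_sum => p _; rewrite ler_piMr ?rnorm_ge0 //.
    by case: (_ \in _); rewrite ?ler01.
  - move=> k X Y; rewrite -!big_split /=; apply: eq_bigr => p _.
    rewrite -!mulrDr in_setU in_setI -!natrD.
    by case: (_ \in X); case: (_ \in Y).
  - by rewrite !divr_gt0.
  - move=> k i ik; have [lA l1 /(_ i ik) eEi] := lP k; have [aE _ _] := EP i.
    rewrite ler_pdivrMr // /lam.
    have := seminorm_combination (q := fun x => abs_sum (E i) (co x))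
      (l k) (abs_sum_coord0 _) (@abs_sum_coordD _) (@abs_sum_coordZ _).
    (* On [E i] the elements of [W i] have mass at most [M] and the others less than [e / 4]. *)
    have : \sum_(p <- l k) N p.1 * abs_sum (E i) (co p.2) <=
        (\sum_(p <- l k) N p.1 * (p.2 \in W i)%:R) * M +
        (\sum_(p <- l k) N p.1) * (e / 4).
      rewrite !mulr_suml -big_split /= big_seq [leRHS]big_seq.
      apply: ler_sum => p /lA pA; rewrite -mulrA -mulrDr.
      apply: ler_wpM2l; first exact: rnorm_ge0.
      case: (boolP (p.2 \in W i)) => [_|/negP pW].
        rewrite mul1r; apply: ler_wpDr; first exact: ltW.
        exact: le_trans (abs_sum_coord_le _ aE) (AM _ pA).
      rewrite mul0r add0r leNgt; apply/negP => ep; apply: pW.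
      by apply/mem_set; split=> //; exact: ltW.
    have : (\sum_(p <- l k) N p.1) * (e / 4) <= 1 * (e / 4).
      by rewrite ler_wpM2r // ltW.
    lra.
have {iotaP} /choice[a aP] := iotaP.
have Aa n : A (a n) by case: (aP n 0%N (leq0n _)).
have [phi hphi [z az]] := coord_cvg_subseq (fun n => AM _ (Aa n)).
have [x xz] := clA _ _ (fun n => Aa (phi n)) az.
have e16 : 0 < e / 16 by rewrite divr_gt0.
(* The limit [x] has mass at most [e / 16] on [E (iota n)], yet [a (phi k)], within [e / 16] of it
   there, has mass at least [e / 4]. *)
have [n xn] := coord_tail x e16.
have [aE nE _] := EP (iota n).
have {}xn : abs_sum (E (iota n)) (co x) <= e / 16.
  apply: xn => // j /nE; apply: leq_ltn_trans; exact: homo_ltn_ge.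
have [k [/= akz nk]] := filter_ex (filterI
  (coord_cvg_abs_sum (E (iota n)) az e16) (nbhs_infty_ge n)).
have [_] := aP (phi k) n (leq_trans nk (homo_ltn_ge hphi k)).
have : abs_sum (E (iota n)) (co (a (phi k))) <=
    abs_sum (E (iota n)) (fun j => co (a (phi k)) j - z j) +
    abs_sum (E (iota n)) (co x).
  apply: le_trans (abs_sumD _ _ _).
  rewrite [leRHS](eq_abs_sum _ (z := co (a (phi k)))) // => j.
  by rewrite xz subrK.
move: akz; rewrite /=; lra.
Qed.

(** * Sufficient conditions for a Banach-Saks set *)

Lemma banach_saks_of_coord (D : set S) M : (forall x, D x -> N x <= M) ->
  (forall e, 0 < e -> exists n, forall x, D x ->
     forall j, (n <= j)%N -> N (co x j) <= e) ->
  coord_closed D -> banach_saks D.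
Proof.
move=> DM Dtail clD u Du.
have [phi hphi [y uy]] := coord_cvg_subseq (fun n => DM _ (Du n)).
have [x xy] := clD _ _ (fun n => Du (phi n)) uy.
pose v n := u (phi n) - x; pose C := M + N x.
have vC n : N (v n) <= C.
  by apply: le_trans (ler_rnormB _ _) _; rewrite lerD2r DM.
have C0 : 0 <= C by apply: le_trans (vC 0%N); exact: rnorm_ge0.
(* Finitely many coordinates are small by convergence, the others by the tails of [D] and of [x]. *)
have v_small d : 0 < d -> \forall n \near \oo, forall j, N (co (v n) j) <= d.
  move=> d0; have d2 : 0 < d / 2 by rewrite divr_gt0.
  have [n1 Dn1] := Dtail _ d2.
  have [n2 xn2] := coord_small x d2.
  have uyd j := uy j d d0.
  apply: filterS (near_all_seq (iota 0 (maxn n1 n2)) uyd) => n un j.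
  rewrite /v coordB; have [jn|] := ltnP j (maxn n1 n2).
    by rewrite xy; apply: ltW; apply: un; rewrite mem_iota.
  rewrite geq_max => /andP[/(Dn1 _ (Du (phi n))) H1 /xn2 H2].
  by have := ler_rnormB (co (u (phi n)) j) (co x j); lra.
have h0 k : 0 < (2^-1 : R) ^+ k by rewrite exprn_gt0 // invr_gt0.
have /choice[T TP] : forall n, exists m, forall E, admissible E ->
    (forall j, j \in E -> (m < j)%N) -> abs_sum E (co (v n)) <= 2^-1 ^+ n.
  by move=> n; exact: coord_tail.
(* Later terms are so flat that any [T m] of their coordinates together weigh at most
   [2^-1 ^+ k]. *)
have [|psi [hpsi _ psiP]] := @sparse_subsequence (fun k m n =>
  forall j, (T m)%:R * N (co (v n) j) <= 2^-1 ^+ k) 0.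
  move=> k m; have T0 : 0 < (T m).+1%:R :> R by rewrite ltr0n.
  have := v_small (2^-1 ^+ k / (T m).+1%:R).
  rewrite divr_gt0 // => /(_ isT); apply: filterS => n vn j.
  apply: le_trans (ler_wpM2l _ (vn j)) _ => //.
  by rewrite mulrCA ger_pMr // ler_pdivrMr // mul1r ler_nat.
have sumC n : N (\sum_(i < n) v (psi i)) <= 2 + C.
  apply: rnorm_le => E aE.
  (* i0 is the first block whose tail threshold T is not below E; admissibility
     then bounds #|E| by T, so that E sees little of the blocks after i0. *)
  have [i0 i0P] : exists i0, forall i,
      abs_sum E (co (v (psi i))) <= 2^-1 ^+ i + (if i == i0 then C else 0).
    have good i : ~~ has (fun j => (j <= T (psi i))%N) E ->
        abs_sum E (co (v (psi i))) <= 2^-1 ^+ i.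
      move=> /hasPn Ei; apply: le_trans (TP _ _ aE _) _.
        by move=> j /Ei; rewrite -ltnNge.
      by rewrite ler_wiXn2l ?homo_ltn_ge // invf_le1 // ler1n.
    have [exi|nexi] := pselect (exists i, has (fun j => (j <= T (psi i))%N) E);
      last first.
      (* Here every block is small on [E], and any [i0] will do. *)
      exists 0%N => i; apply: ler_wpDr; first by case: ifP.
      by apply: good; apply/negP => Ei; apply: nexi; exists i.
    case: (ex_minnP exi) => i0 /hasP[j0 j0E j0T] i0min; exists i0 => i.
    case: ltngtP => [ii0|i0i|->].
    - rewrite addr0 good //; apply: contraL ii0 => /i0min.
      by rewrite -leqNgt.
    - have T0 : 0 < (T (psi i0))%:R :> R.
        by rewrite ltr0n (leq_trans (admissible_gt0 aE j0E)).
      rewrite addr0; apply: le_trans (abs_sum_le_card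
        (M := 2^-1 ^+ i / (T (psi i0))%:R) _) _.
        by move=> j _; rewrite ler_pdivlMr // mulrC; exact: psiP.
      rewrite mulrCA ger_pMr // ler_pdivrMr // mul1r ler_nat.
      exact: leq_trans (aE _ j0E) j0T.
    - apply: ler_wpDl; first exact: ltW.
      exact: le_trans (abs_sum_coord_le _ aE) (vC _).
  have abs_sum_v : abs_sum E (co (\sum_(i < n) v (psi i))) <=
      \sum_(i < n) abs_sum E (co (v (psi i))).
    rewrite -(big_mkord xpredT (fun i => v (psi i))).
    rewrite -(big_mkord xpredT (fun i => abs_sum E (co (v (psi i))))).
    elim: (index_iota 0 n) => [|i s IH].
      by rewrite !big_nil abs_sum_coord0.
    by rewrite !big_cons (le_trans (abs_sum_coordD _ _ _)) // lerD2l.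
  apply: le_trans abs_sum_v _.
  apply: (@le_trans _ _ (\sum_(i < n)
      (2^-1 ^+ i + (if i == i0 :> nat then C else 0)))).
    by apply: ler_sum => i _; exact: i0P.
  rewrite big_split /=.
  apply: lerD (sum_half_le2 R n) _.
  suff -> : \sum_(i < n) (if i == i0 :> nat then C else 0) =
      if (i0 < n)%N then C else 0 by case: ifP.
  elim: n => [|n IH]; first by rewrite big_ord0.
  rewrite big_ord_recr /= IH ltnS [n == i0]eq_sym.
  by case: (ltngtP i0 n); rewrite ?addr0 ?add0r.
exists (phi \o psi); first by move=> m n mn; exact/hphi/hpsi.
apply/cvg_ex; exists x; apply/cvg_rnormP => e e0.
have C2 : 0 < 2 + C by rewrite ltr_wpDr.
have eC : 0 < e / (2 + C) by rewrite divr_gt0.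
apply: filterS (near_infty_natSinv_lt (PosNum eC)) => n /= ne.
rewrite arith_meanB rnormZ // rnorm_natV //.
apply: le_lt_trans (_ : n.+1%:R^-1 * (2 + C) < e).
  by rewrite ler_wpM2l ?invr_ge0 //; exact: sumC.
by rewrite -ltr_pdivlMr.
Qed.

(** * Passage of the Banach-Saks property to the hull *)

Lemma banach_saks_absconvex_approx (A : set S) :
  banach_saks A -> banach_saks (absconvex_approx A).
Proof.
move=> bsA.
have [M AM] := banach_saks_bounded bsA.
(* If [A] is empty, [M] may be negative, while [absconvex_approx A] still contains 0. *)
have AM0 a : A a -> N a <= Num.max M 0 by move=> /AM aM; rewrite le_max aM.
have M0 : 0 <= Num.max M 0 by rewrite le_max lexx orbT.
apply: (@banach_saks_of_coord _ (Num.max M 0)).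
- apply: (seminorm_approx_le (q := fun x => N x)) => //.
  + by rewrite rnorm0.
  + by move=> *; exact: ler_rnormD.
  + by move=> a x; rewrite rnormZ.
- move=> e e0.
  have [n An] := banach_saks_unif_tail bsA e0.
  exists n => x Dx j nj; move: x Dx.
  apply: (seminorm_approx_le (q := fun x => N (co x j))).
  + exact: ltW.
  + by rewrite coord0 rnorm0.
  + by move=> x y; rewrite coordD ler_rnormD.
  + by move=> a x; rewrite coordZ rnormM.
  + by move=> x; exact: rnorm_coord_le.
  + by move=> a Aa; exact: An.
- apply: (coord_closed_hull AM0) => u y uA uy.
  have [_ _ [x xy _]] := banach_saks_coord_cvg bsA uA uy.
  by exists x.
Qed.

End Schreier.

Lemma banach_saks_subset (K : numFieldType) (V : normedModType K)
    (A B : set V) : A `<=` B -> banach_saks B -> banach_saks A.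
Proof. by move=> AB bsB u uA; apply: bsB => n; exact/AB/uA. Qed.

Theorem corollary17 (R : realType) (K : numFieldType)
    (hK : scalar_field R K)
    (S : completeNormedModType K) (iota : {linear c00 K -> S})
    (hS : schreier_space iota)
    (A : set S) (hA : banach_saks A) :
  banach_saks (absconvex_closed_hull A).
Proof.
have [rho [rho_le rho_real rho_ultra]] := scalar_field_emb hK.
have [co co_approx] := coordinates rho_le rho_real rho_ultra hS.
have hullA := absconvex_closed_hull_approx rho_le rho_real (A := A).
apply: banach_saks_subset hullA _.
exact: (banach_saks_absconvex_approx rho_le rho_real rho_ultra hS co_approx).
Qed.
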